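(* Let $\mathcal{E}$ be a finite-dimensional Euclidean space, $\alpha\in(0,1)$, and let $T_1,\ldots,T_m:\mathcal{E}\to\mathcal{E}$ be $\alpha$-averaged operators such that $F:=\bigcap_{i=1}^m\mathrm{Fix}\,T_i$ is nonempty and $F\neq\mathcal{E}$. Let $\{x^k\}$ be generated by the quasi-cyclic algorithm $$x^{k+1}=\sum_{i=1}^m w_i^k T_i(x^k),\qquad k\in\mathbb{N},$$ where $w_i^k\ge0$, $\sum_{i=1}^m w_i^k=1$, and $\nu:=\inf_{k\in\mathbb{N}}\min_{i\in I_+(k)}w_i^k>0$ with $I_+(k):=\{1\le i\le m\mid w_i^k>0\}$. Then $\{x^k\}$ is bounded. Let $B$ be a bounded set containing $\{x^k\}$ and suppose that: (a) $T_1,\ldots,T_m$ are jointly Karamata regular (Karamata regular when $m=1$) over $B$ with regularity function $\psi_B$; (b) there exists an integer $s>0$ such that for each $k\in\mathbb{N}$, $I_+(k)\cup I_+(k+1)\cup\cdots\cup I_+(k+s-1)=\{1,\ldots,m\}$. Fix any $\widehat a>\mathrm{dist}^2(x^0,F)$ and $\delta>0$ and define $$\widehat\phi(u):=\psi_B^2\Big(\sqrt{\tfrac{2\alpha(1+4\nu s)}{\nu(1-\alpha)}u}\Big),\qquad \phi:=\widehat\phi|_{(0,\widehat a]},\qquad \Phi_\phi(u):=\int_u^\delta\frac{1}{\phi^-(t)}\,dt,\quad u>0.$$ Then $\{x^k\}$ converges to some $x^*\in F$, and either the convergence is finite or the convergence rate is given by $$\mathrm{dist}(x^k,F)\le\sqrt{\Phi_\phi^{-1}\big(\Phi_\phi(\mathrm{dist}^2(x^0,F))+\lfloor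 k/s\rfloor\big)},\qquad\forall k\in\mathbb{N}.$$
   Context: $\mathbb{N}$ includes $0$. $\mathrm{Fix}\,T=\{x\mid T(x)=x\}$. $T$ is $\alpha$-averaged if $T=(1-\alpha)I+\alpha R$ for some nonexpansive $R$, where $I$ is the identity. ''Finite convergence to $x^*$'' means $x^k=x^*$ for all sufficiently large $k$. Minus generalized inverse: for $f:(0,a]\to(0,\infty)$ with $\lim_{x\to0_+}f(x)=0$, $f^-(y):=\sup\{x\in(0,a]\mid f(x)<y\}$ for $y>0$. The function $\Phi_\phi$ on $(0,\infty)$ is continuous and decreasing, and $\Phi_\phi^{-1}$ is its usual inverse (defined on the range of $\Phi_\phi$). Regular variation at $0$: a Lebesgue measurable function $f:(0,a]\to(0,\infty)$ belongs to $\mathrm{RV}^0_\rho$ ($\rho\in\mathbb{R}$) if $\lim_{x\to0_+}f(\lambda x)/f(x)=\lambda^\rho$ for all $\lambda>0$. Joint Karamata regularity: operators $L_1,\ldots,L_n:\mathcal{E}\to\mathcal{E}$ with $C:=\bigcap_{i=1}^n\mathrm{Fix}\,L_i\ne\emptyset$ are jointly Karamata regular over a bounded set $B$ if there is a function $\psi_B:\mathbb{R}_+\to\mathbb{R}_+$ (a regularity function) such that: (1) $\mathrm{dist}(x,C)\le\psi_B(\max_{1\le i\le n}\|x-L_i(x)\|)$ for all $x\in B$; (2) $\psi_B$ is nondecreasing with $\lim_{t\to0_+}\psi_B(t)=\psi_B(0)=0$; (3) for some $a>0$, $\psi_B|_{(0,a]}\in\mathrm{RV}^0_\rho$ for some $\rho\in[0,1]$.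 (In particular $\psi_B(t)>0$ for $t>0$.) For $n=1$ one says ''Karamata regular''. *)

(* Defs.v *)
From HB Require Import structures.
From mathcomp Require Import all_boot all_order all_algebra sesquilinear.
From mathcomp Require Import all_classical all_reals all_analysis.

Set Implicit Arguments.
Unset Strict Implicit.
Unset Printing Implicit Defensive.

Import Order.TTheory GRing.Theory Num.Theory.
Import numFieldNormedType.Exports.

Local Open Scope classical_set_scope.
Local Open Scope ring_scope.

(* A finite-dimensional Euclidean space is a [vectType] over the reals together
   with a real inner product [ip : {dot E for idfun}]; the norm, the distance,
   boundedness and convergence are those of the inner product. *)
Section euclidean.
Context {R : realType} {E : vectType R} (ip : {dot E for idfun}).

Definition eucl_norm (x : E) : R := Num.sqrt (ip x x).

Definition eucl_dist (x : E) (C : set E) : R := inf [set eucl_norm (x - y) | y in C].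

Definition eucl_bounded (B : set E) : Prop :=
  exists M : R, forall x, B x -> eucl_norm x <= M.

Definition eucl_cvg (x : nat -> E) (l : E) : Prop :=
  (fun k => eucl_norm (x k - l)) @ \oo --> (0 : R).

Definition nonexpansive (T : E -> E) : Prop :=
  forall x y, eucl_norm (T x - T y) <= eucl_norm (x - y).

Definition averaged (alpha : R) (T : E -> E) : Prop :=
  exists2 N : E -> E, nonexpansive N &
    forall x, T x = (1 - alpha) *: x + alpha *: N x.

Definition fixpoints (T : E -> E) : set E := [set x | T x = x].

Definition common_fixpoints (n : nat) (L : 'I_n -> E -> E) : set E :=
  \bigcap_i fixpoints (L i).

End euclidean.

Section regular_variation.
Context {R : realType}.

(* Lebesgue (not merely Borel) measurability: the domain carries the
   sigma-algebra of the Caratheodory-measurable sets of the Lebesgue outer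
   measure, i.e. the one of [completed_lebesgue_measure]. *)
Definition lebesgue_measurable_fun (D : set R) (f : R -> R) : Prop :=
  measurable_fun (D : set (caratheodory_type ((wlength idfun)^*)%mu)) f.

(* Only the values of [f] on (0, a] matter. *)
Definition RV0 (rho a : R) (f : R -> R) : Prop :=
  [/\ forall x, 0 < x <= a -> 0 < f x,
      lebesgue_measurable_fun `]0, a] f &
      forall lambda, 0 < lambda ->
        f (lambda * x) / f x @[x --> 0^'+] --> lambda `^ rho].

(* The minus generalized inverse of the restriction of [f] to (0, a]. *)
Definition minus_inv (a : R) (f : R -> R) (y : R) : R :=
  sup [set x | 0 < x <= a /\ f x < y].

Definition oriented_integral (f : R -> R) (u v : R) : R :=
  if u <= v then (\int[lebesgue_measure]_(t in `[u, v]) f t)%R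
  else - (\int[lebesgue_measure]_(t in `[v, u]) f t)%R.

(* [Phi a f delta] is Phi_phi for phi the restriction of [f] to (0, a]. *)
Definition Phi (a : R) (f : R -> R) (delta u : R) : R :=
  oriented_integral (fun t => (minus_inv a f t)^-1) u delta.

(* The inverse of Phi_phi : (0, +oo) -> R; its values outside the range of
   Phi_phi are meaningless. *)
Definition Phi_inv (a : R) (f : R -> R) (delta : R) : R -> R :=
  'pinv_(fun=> 0) `]0, +oo[ (Phi a f delta).

End regular_variation.

Section karamata.
Context {R : realType} {E : vectType R} (ip : {dot E for idfun}).

(* [psi] stands for a function on [0, +oo); its values at negative arguments
   are irrelevant.  The default value 0 of the maximum is harmless, as the
   terms are nonnegative. *)
Definition jointly_Karamata_regular (n : nat) (L : 'I_n -> E -> E)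
    (B : set E) (psi : R -> R) : Prop :=
  [/\ common_fixpoints L !=set0,
      eucl_bounded ip B,
      forall t, 0 <= t -> 0 <= psi t &
   [/\ forall x, B x ->
         eucl_dist ip x (common_fixpoints L) <=
         psi (\big[Num.max/0]_(i < n) eucl_norm ip (x - L i x)),
       [/\ forall t u, 0 <= t -> t <= u -> psi t <= psi u,
           psi t @[t --> 0^'+] --> (0 : R) &
           psi 0 = 0] &
       exists a rho : R, [/\ 0 < a, 0 <= rho <= 1 & RV0 rho a psi]]].

End karamata.

Section weights.
Context {R : realType} {m : nat} (w : nat -> 'I_m -> R).

Definition Iplus (k : nat) : {set 'I_m} := [set i | 0 < w k i].

(* For weights in [0, 1] summing to 1, [Iplus k] is nonempty and the default
   value 1 does not affect the minimum. *)
Definition weight_inf : R :=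
  inf [set \big[Num.min/1]_(i in Iplus k) w k i | k in [set: nat]].

End weights.

Definition phihat {R : realType} (alpha nu : R) (s : nat) (psi : R -> R)
    (u : R) : R :=
  psi (Num.sqrt
    (2 * alpha * (1 + 4 * nu * s%:R) / (nu * (1 - alpha)) * u)) ^+ 2.

(* Main.v *)
(* Convexity and averagedness give, for every z in F,
     |x^(k+1) - z|^2 + (1 - alpha) / alpha * e_k <= |x^k - z|^2
   where e_k = \sum_i w_i^k |x^k - T_i x^k|^2.  Within s steps every index i
   becomes active, and Cauchy-Schwarz bounds |x^k - T_i x^k|^2 by
   (8 s + 2 / nu) times the sum of e_k, ..., e_(k+s-1).  Regularity then yields
   t_n <= phihat (t_n - t_(n+1)) for t_n = dist^2(x^(n s), F), that is
   phi^-(t_n) <= t_n - t_(n+1).  As phi^- is nondecreasing, 1/phi^- has integral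
   at least 1 over [t_(n+1), t_n], so Phi(t_n) >= Phi(t_0) + n.  Convergence
   follows from t_n -> 0, Fejer monotonicity and completeness. *)
Require Import Defs.
From HB Require Import structures.
From mathcomp Require Import all_boot all_order all_algebra sesquilinear.
From mathcomp Require Import all_classical all_reals all_analysis.
From mathcomp Require Import ring lra measurable_realfun.

Set Implicit Arguments.
Unset Strict Implicit.
Unset Printing Implicit Defensive.

Import Order.TTheory GRing.Theory Num.Theory.
Import numFieldNormedType.Exports.

Local Open Scope classical_set_scope.
Local Open Scope ring_scope.

(** * Inner-product geometry and completeness *)

Section euclidean_norm.
Context {R : realType} {E : vectType R} (ip : {dot E for idfun}).
Implicit Types (u v x y z : E) (a : R).
Local Notation N := (eucl_norm ip).

Lemma ipC u v : ip u v = ip v u.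
Proof. by rewrite [LHS]hermC mul1r. Qed.

Lemma ip_gt0 u : u != 0 -> 0 < ip u u.
Proof. exact: neq0_dnorm_gt0. Qed.

Lemma ip_ge0 u : 0 <= ip u u.
Proof. by have [->|/ip_gt0/ltW//] := eqVneq u 0; rewrite linear0l. Qed.

Lemma ip_sumr (I : Type) (r : seq I) (P : pred I) (F : I -> E) u :
  ip u (\sum_(i <- r | P i) F i) = \sum_(i <- r | P i) ip u (F i).
Proof. exact: linear_sumr. Qed.

Lemma ip_suml (I : Type) (r : seq I) (P : pred I) (F : I -> E) u :
  ip (\sum_(i <- r | P i) F i) u = \sum_(i <- r | P i) ip (F i) u.
Proof. exact: linear_sumlz. Qed.

Lemma ipDl u v x : ip (u + v) x = ip u x + ip v x.
Proof. exact: linearDl. Qed.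
Lemma ipDr u v x : ip x (u + v) = ip x u + ip x v.
Proof. exact: linearDr. Qed.
Lemma ipNl u x : ip (- u) x = - ip u x.
Proof. exact: linearNl. Qed.
Lemma ipNr u x : ip x (- u) = - ip x u.
Proof. exact: linearNr. Qed.
Lemma ipZl a u x : ip (a *: u) x = a * ip u x.
Proof. exact: linearZl_LR. Qed.
Lemma ipZr a u x : ip x (a *: u) = a * ip x u.
Proof. exact: linearZr_LR. Qed.

Lemma eucl_norm_ge0 u : 0 <= N u.
Proof. exact: sqrtr_ge0. Qed.

Lemma eucl_norm_sqr u : N u ^+ 2 = ip u u.
Proof. by rewrite sqr_sqrtr ?ip_ge0. Qed.

Lemma ler_eucl_norm u v : (N u <= N v) = (ip u u <= ip v v).
Proof. by rewrite -!eucl_norm_sqr ler_sqr ?nnegrE ?eucl_norm_ge0. Qed.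

Lemma eucl_normN u : N (- u) = N u.
Proof. by rewrite /eucl_norm ipNl ipNr opprK. Qed.

Lemma eucl_normB u v : N (u - v) = N (v - u).
Proof. by rewrite -eucl_normN opprB. Qed.

Lemma eucl_norm0 : N 0 = 0.
Proof. by rewrite /eucl_norm linear0l sqrtr0. Qed.

Lemma eucl_norm_eq0 u : N u = 0 -> u = 0.
Proof.
move=> Nu0; apply: contrapT => /eqP /ip_gt0.
by rewrite -eucl_norm_sqr Nu0 expr0n ltxx.
Qed.

Lemma eucl_normZ a u : N (a *: u) = `|a| * N u.
Proof.
by rewrite /eucl_norm ipZl ipZr mulrA -expr2 sqrtrM ?sqr_ge0// sqrtr_sqr.
Qed.

Lemma cauchy_schwarz u v : `|ip u v| <= N u * N v.
Proof.
rewrite -ler_sqr ?nnegrE ?mulr_ge0 ?eucl_norm_ge0//.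
rewrite real_normK ?num_real// exprMn !eucl_norm_sqr.
have [->|/ip_gt0 v0] := eqVneq v 0.
  by rewrite [X in X ^+ 2]linear0r expr0n mulr_ge0 ?ip_ge0.
(* The squared norm of this vector is |v|^2 (|u|^2 |v|^2 - <u, v>^2); the scaling by |v|^2 avoids a
   division. *)
have := ip_ge0 (ip v v *: u - ip u v *: v).
rewrite !(ipDl, ipDr, ipNl, ipNr, ipZl, ipZr) (ipC v u).
move=> H; rewrite -subr_ge0 -(pmulr_rge0 _ v0) (le_trans H)// le_eqVlt.
by apply/orP; left; apply/eqP; ring.
Qed.

Lemma ler_eucl_normD u v : N (u + v) <= N u + N v.
Proof.
rewrite -ler_sqr ?nnegrE ?addr_ge0 ?eucl_norm_ge0//.
rewrite sqrrD !eucl_norm_sqr ipDl !ipDr (ipC v u).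
have := le_trans (ler_norm _) (cauchy_schwarz u v); lra.
Qed.

Lemma ler_eucl_dist_add y x z : N (x - z) <= N (x - y) + N (y - z).
Proof. by rewrite -[x - z](subrKA y) ler_eucl_normD. Qed.

Lemma ler_eucl_norm_sum (I : finType) (F : I -> E) :
  N (\sum_i F i) <= \sum_i N (F i).
Proof.
elim/big_ind2 : _ => //; first by rewrite eucl_norm0.
by move=> u a v b ua vb; rewrite (le_trans (ler_eucl_normD _ _)) ?lerD.
Qed.

(* The gap is the variance [\sum_i w i * N (F i - \sum_j w j *: F j) ^+ 2]. *)
Lemma ip_convex (I : finType) (w : I -> R) (F : I -> E) :
  (forall i, 0 <= w i) -> \sum_i w i = 1 ->
  ip (\sum_i w i *: F i) (\sum_i w i *: F i) <= \sum_i w i * ip (F i) (F i).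
Proof.
move=> w0 w1; set b := \sum_i w i *: F i; rewrite -subr_ge0.
have -> : \sum_i w i * ip (F i) (F i) - ip b b =
    \sum_i w i * ip (F i - b) (F i - b).
  have Eb : \sum_i w i * ip (F i) b = ip b b.
    by rewrite {2}/b ip_suml; apply: eq_bigr => i _; rewrite ipZl.
  have -> : \sum_i w i * ip (F i - b) (F i - b) =
      \sum_i (w i * ip (F i) (F i) - 2 * (w i * ip (F i) b) + w i * ip b b).
    apply: eq_bigr => i _.
    by rewrite !(ipDl, ipDr, ipNl, ipNr) (ipC b (F i)); ring.
  rewrite big_split sumrB/= -mulr_sumr -mulr_suml Eb w1; ring.
by apply: sumr_ge0 => i _; rewrite mulr_ge0 ?ip_ge0.
Qed.

(** Convexity of the squared norm with equal weights 1/n, multiplied through by n^2. *)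
Lemma ip_sum_le n (F : 'I_n -> E) :
  ip (\sum_i F i) (\sum_i F i) <= n%:R * \sum_i ip (F i) (F i).
Proof.
case: n F => [|n] F; first by rewrite big_ord0 linear0l mul0r.
have n0 : (n.+1%:R : R) != 0 by rewrite pnatr_eq0.
have w1 : \sum_(i < n.+1) (n.+1%:R^-1 : R) = 1.
  by rewrite sumr_const card_ord -[LHS]mulr_natl mulfV.
have w0 (i : 'I_n.+1) : 0 <= (n.+1%:R : R)^-1 by rewrite invr_ge0.
have := ip_convex F w0 w1.
rewrite -scaler_sumr -mulr_sumr ipZl ipZr.
by rewrite ler_pM2l ?invr_gt0 ?ltr0n// ler_pdivrMl ?ltr0n.
Qed.

(** Once coordinates are inner products with fixed vectors, Cauchy-Schwarz makes them Lipschitz for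
    the norm. The vectors come from the inverse Gram matrix of the basis. *)
Lemma dual_basis (n := \dim {:E}) : exists b : 'I_n -> E,
  forall i u, coord (vbasis {:E}) i u = ip (b i) u.
Proof.
pose e (i : 'I_n) := (vbasis {:E})`_i.
pose G : 'M[R]_n := \matrix_(i, j) ip (e i) (e j).
have Gu : G \in unitmx.
  (* A kernel vector of the Gram matrix gives a combination [u] orthogonal to every basis vector,
     hence to itself. *)
  rewrite -row_free_unit; apply: inj_row_free => v vG0.
  pose u := \sum_i v 0 i *: e i.
  have ue j : ip u (e j) = 0.
    have := congr1 (fun M : 'rV_n => M 0 j) vG0; rewrite !mxE => vGj.
    rewrite -[RHS]vGj ip_suml; apply: eq_bigr => i _.
    by rewrite ipZl !mxE.
  have u0 : u = 0.
    apply: contrapT => /eqP/ip_gt0; rewrite {2}/u ip_sumr big1 ?ltxx// => i _.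
    by rewrite ipZr ue mulr0.
  apply/rowP => i; rewrite mxE.
  have /freeP := basis_free (vbasisP {:E}).
  by apply; exact: u0.
pose b i := \sum_k invmx G i k *: e k.
have be (i j : 'I_n) : ip (b i) (e j) = (i == j)%:R :> R.
  have := congr1 (fun M : 'M[R]_n => M i j) (mulVmx Gu); rewrite !mxE => <-.
  by rewrite ip_suml; apply: eq_bigr => k _; rewrite ipZl !mxE.
exists b => i u.
rewrite {2}(coord_vbasis (memvf u)) ip_sumr (bigD1 i)//= big1 ?addr0 => [|j ji].
  by rewrite ipZr be eqxx mulr1.
by rewrite ipZr be eq_sym (negbTE ji) mulr0.
Qed.

(** By [dual_basis] each coordinate sequence is Cauchy in the reals; the limit is rebuilt from the
    coordinate limits. *)
Lemma eucl_complete (x : nat -> E) :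
  (forall e, 0 < e -> exists K, forall k, (K <= k)%N -> N (x k - x K) <= e) ->
  exists l, eucl_cvg ip x l.
Proof.
move=> xC; have [b bE] := dual_basis.
pose e i := (vbasis {:E})`_i.
pose c i k := coord (vbasis {:E}) i (x k).
have c_cvg i : cvgn (c i).
  apply/cauchy_cvgP/cauchy_exP => r r0.
  (* The [+ 1] secures a positive divisor whatever the norm of [b i]. *)
  have b0 : 0 < N (b i) + 1 by rewrite ltr_wpDl ?eucl_norm_ge0.
  have [K xK] := xC (r / 2 / (N (b i) + 1)) ltac:(by rewrite !divr_gt0).
  exists (c i K); exists K => // k /= Kk; rewrite /ball/=.
  rewrite distrC -linearB/= bE (le_lt_trans (cauchy_schwarz _ _))//.
  rewrite (@le_lt_trans _ _ (r / 2))//; last by rewrite ltr_pdivrMr//; lra.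
  have := xK k Kk; rewrite ler_pdivlMr// mulrC; apply: le_trans.
  by rewrite ler_wpM2r ?eucl_norm_ge0// lerDl.
exists (\sum_i limn (c i) *: e i); rewrite /eucl_cvg.
apply: (@squeeze_cvgr _ _ _ _ (fun=> 0)
  (fun k => \sum_i `|c i k - limn (c i)| * N (e i))).
- near=> k; rewrite eucl_norm_ge0/=.
  rewrite {1}(coord_vbasis (memvf (x k))) -sumrB.
  apply: (le_trans (ler_eucl_norm_sum _)); apply: ler_sum => i _.
  by rewrite -scalerBl eucl_normZ.
- exact: cvg_cst.
- rewrite [X in _ --> X](_ : 0 = \sum_(i < \dim {:E}) (0 * N (e i))); last first.
    by rewrite big1// => i _; rewrite mul0r.
  apply: cvg_big => [|i _]; first exact: add_continuous.
  by apply: cvgMr_tmp; apply/norm_cvg0P/subr_cvg0; exact: c_cvg.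
Unshelve. all: by end_near. Qed.

End euclidean_norm.

(** * Integrals of a positive nonincreasing function on (0, +oo) *)

Section nonincreasing_integral.
Context {R : realType} (g : R -> R) (c : R).
Hypothesis g_ni : forall s t, 0 < s -> s <= t -> g t <= g s.
Hypothesis c0 : 0 < c.
Hypothesis gc : forall t, 0 < t -> c <= g t.
Local Notation mu := (@lebesgue_measure R).
Local Notation int u v := (\int[mu]_(t in `[u, v]) g t)%R.

Lemma integrable_nonincreasing u v : 0 < u -> mu.-integrable `[u, v] (EFin \o g).
Proof.
move=> u0; apply: measurable_bounded_integrable => //.
- by rewrite /= lebesgue_measure_itv/=; case: ifPn => // _; rewrite -EFinB ltry.
(* Monotonicity is known only at positive arguments; truncating at [u] gives a function
   nonincreasing on the whole line that agrees with [g] on the interval. *)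
- apply: (eq_measurable_fun (fun t => g (Num.max u t))).
    by move=> t; rewrite inE/= in_itv/= => /andP[ut _]; rewrite max_r.
  apply: nonincreasing_measurable => // s t st.
  apply: g_ni; first by rewrite lt_max u0.
  by rewrite ge_max !le_max lexx st orbT.
- exists (g u); split; first exact: num_real.
  move=> M uM t /=; rewrite in_itv/= => /andP[ut _].
  have t0 := lt_le_trans u0 ut.
  rewrite ger0_norm ?(le_trans (g_ni u0 ut)) ?(ltW uM)//.
  by rewrite (le_trans (ltW c0)) ?gc.
Qed.

Lemma int_nonincreasingD u v w : 0 < u -> u <= v -> v <= w ->
  int u w = int u v + int v w.
Proof.
move=> u0 uv vw; have v0 := lt_le_trans u0 uv.
apply/eqP; rewrite addrC -subr_eq Rintegral_itvB ?bnd_simp//; last first.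
  exact: integrable_nonincreasing.
rewrite Rintegral_itv_obnd_cbnd//.
apply: integrableS (integrable_nonincreasing w v0) => //.
by apply: subset_itvr; rewrite bnd_simp.
Qed.

Lemma int_nonincreasing_bounds u v : 0 < u -> u <= v ->
  (v - u) * g v <= int u v <= (v - u) * g u.
Proof.
move=> u0 uv.
have cst r : (\int[mu]_(t in `[u, v]) r)%R = (v - u) * r.
  rewrite Rintegral_cst//= mulrC lebesgue_measure_itv/= lte_fin.
  by case: ltgtP uv => // ->; rewrite subrr !(mul0r,mulr0).
have int_cst r : mu.-integrable `[u, v] (EFin \o fun=> r).
  apply: measurable_bounded_integrable => //.
    by rewrite /= lebesgue_measure_itv/=; case: ifPn => // _; rewrite -EFinB ltry.
  exists `|r|; split; first exact: num_real.
  by move=> M rM t _ /=; exact: ltW.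
by rewrite -!cst; apply/andP; split; apply: le_Rintegral => //;
  do ?[exact: integrable_nonincreasing|exact: int_cst];
  move=> t /=; rewrite in_itv/= => /andP[ut tv]; apply: g_ni => //;
  rewrite (lt_le_trans u0).
Qed.

(** * The primitive [G]: strict decrease, continuity and intermediate values *)

Variable delta : R.
Hypothesis delta0 : 0 < delta.
Local Notation G u := (oriented_integral g u delta).

(** [delta] may lie right of, between or left of the two points; the sign convention for reversed
    bounds yields the same difference each time. *)
Lemma oriented_integralB u v : 0 < u -> u <= v -> G u - G v = int u v.
Proof.
move=> u0 uv; have v0 := lt_le_trans u0 uv; rewrite /oriented_integral.
have [vd|dv] := leP v delta.
  by rewrite (le_trans uv vd) (int_nonincreasingD u0 uv vd) addrK.
have [ud|du] := leP u delta.
  by rewrite (int_nonincreasingD u0 ud (ltW dv)) opprK.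
by rewrite (int_nonincreasingD delta0 (ltW du) uv); ring.
Qed.

Lemma oriented_integral_lt u v : 0 < u -> u < v -> G v < G u.
Proof.
move=> u0 uv; rewrite -subr_gt0 oriented_integralB ?ltW//.
have /andP[+ _] := int_nonincreasing_bounds u0 (ltW uv).
apply: lt_le_trans; rewrite mulr_gt0 ?subr_gt0//.
by rewrite (lt_le_trans c0) ?gc// (lt_trans u0).
Qed.

Lemma oriented_integral_inj : {in `]0, +oo[%classic &, injective (fun u => G u)}.
Proof.
move=> u v; rewrite !inE/= !in_itv/= !andbT => u0 v0 Guv.
case: (ltgtP u v) => // [uv|vu].
  by have := oriented_integral_lt u0 uv; rewrite Guv ltxx.
by have := oriented_integral_lt v0 vu; rewrite Guv ltxx.
Qed.

(** The integrand is at most [g p] on [p, +oo). The constant depends on [p] because [g] may blow up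
    at 0. *)
Lemma oriented_integral_lipschitz p u v : 0 < p -> p <= u -> p <= v ->
  `|G u - G v| <= g p * `|u - v|.
Proof.
move=> p0; wlog uv : u v / u <= v => [H pu pv|pu pv].
  have [/H|/ltW/H] := leP u v; first exact.
  by rewrite distrC (distrC u); exact.
have u0 := lt_le_trans p0 pu; have v0 := lt_le_trans p0 pv.
have /andP[lo hi] := int_nonincreasing_bounds u0 uv.
rewrite oriented_integralB// distrC !ger0_norm ?subr_ge0//.
  by rewrite (le_trans hi)// mulrC ler_wpM2r ?subr_ge0// g_ni.
by rewrite (le_trans _ lo)// mulr_ge0 ?subr_ge0// (le_trans (ltW c0)) ?gc.
Qed.

Lemma oriented_integral_continuous u : 0 < u ->
  {for u, continuous (fun u => G u)}.
Proof.
move=> u0; apply/cvgrPdist_le => e e0.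
(* All points close to [u] stay above u / 2, so the Lipschitz bound applies there with p = u / 2. *)
have p0 : 0 < u / 2 by rewrite divr_gt0.
have gp0 := lt_le_trans c0 (gc p0).
near=> v.
apply: (@le_trans _ _ (g (u / 2) * `|u - v|)).
  apply: oriented_integral_lipschitz => //; first lra.
  by near: v; apply: (cvgr_ge u) => //; lra.
rewrite mulrC -ler_pdivlMr//.
by near: v; apply: cvgr_dist_le => //; rewrite divr_gt0.
Unshelve. all: by end_near. Qed.

(** Intermediate value theorem for a decreasing function, whose larger value is at the left
    endpoint. The bound [u <= z] later becomes the rate estimate. *)
Lemma oriented_integral_image u v y : 0 < u -> u <= v -> G v <= y <= G u ->
  exists2 z, u <= z & G z = y.
Proof.
move=> u0 uv yG.
have [||z] := @IVT R (fun u => G u) u v y uv.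
- apply: continuous_in_subspaceT => z; rewrite inE/= in_itv/= => /andP[uz _].
  by apply: oriented_integral_continuous; exact: lt_le_trans uz.
- have /andP[yv yu] := yG; have Gvu := le_trans yv yu.
  by rewrite min_r// max_l.
by rewrite in_itv/= => /andP[uz _] <-; exists z.
Qed.

End nonincreasing_integral.

(** * Rate for a scalar recursion [t n <= f (t n - t n.+1)] *)

Section rate.
Context {R : realType} (f : R -> R) (a : R).
Hypothesis f_nd : forall s t, 0 <= s -> s <= t -> f s <= f t.
Hypothesis f_small : forall y, 0 < y -> exists2 u, 0 < u <= a & f u < y.

Let has_sup_minus_inv y : 0 < y -> has_sup [set x | 0 < x <= a /\ f x < y].
Proof.
move=> y0; split; first by have [u ua fu] := f_small y0; exists u.
by exists a => u /= [/andP[]].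
Qed.

Lemma minus_inv_gt0 y : 0 < y -> 0 < minus_inv a f y.
Proof.
move=> y0; have [u ua fu] := f_small y0; have /andP[u0 _] := ua.
by apply: (lt_le_trans u0); apply: ub_le_sup => //; case: (has_sup_minus_inv y0).
Qed.

Lemma minus_inv_le y : 0 < y -> minus_inv a f y <= a.
Proof.
move=> y0; apply: ge_sup; first by case: (has_sup_minus_inv y0).
by move=> u [/andP[]].
Qed.

Lemma minus_inv_nd s t : 0 < s -> s <= t -> minus_inv a f s <= minus_inv a f t.
Proof.
move=> s0 st; apply: ge_sup; first by case: (has_sup_minus_inv s0).
move=> u [ua fus]; apply: ub_le_sup.
  by case: (has_sup_minus_inv (lt_le_trans s0 st)).
by split => //; exact: lt_le_trans st.
Qed.

(** Since [f] is nondecreasing, every [u] with [f u < y] lies below [d]. Applied to the recursion,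
    this bounds each decrease of [t] from below. *)
Lemma minus_inv_le_of y d : 0 < y -> 0 <= d -> y <= f d -> minus_inv a f y <= d.
Proof.
move=> y0 d0 yd; apply: ge_sup; first by case: (has_sup_minus_inv y0).
move=> u [/andP[u0 _] fu]; rewrite leNgt; apply/negP => du.
by have := lt_le_trans fu (le_trans yd (f_nd d0 (ltW du))); rewrite ltxx.
Qed.

Variable t : nat -> R.
Hypothesis t_step : forall n, t n <= f (t n - t n.+1).
Hypothesis t_ni : forall n, t n.+1 <= t n.

(** If [t] stayed above [e], each decrease would be at least a fixed [u > 0] with [f u < e], and [t]
    would fall below any bound linearly. *)
Lemma step_cvg0 e : 0 < e -> exists n, t n < e.
Proof.
move=> e0; apply: contrapT => /forallNP te.
have {}te n : e <= t n by have /negP := te n; rewrite -leNgt.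
have [u /andP[u0 _] fu] := f_small e0.
have tu n : u <= t n - t n.+1.
  rewrite leNgt; apply/negP => tnu.
  have := le_trans (te n) (t_step n); rewrite leNgt => /negP; apply.
  by rewrite (le_lt_trans _ fu)// f_nd ?subr_ge0 ?t_ni ?ltW.
have tn n : t n <= t 0%N - n%:R * u.
  elim: n => [|n IH]; first by rewrite mul0r subr0.
  by have := tu n; rewrite mulrS mulrDl mul1r; lra.
have [n nN] : exists n : nat, t 0%N / u < n%:R.
  by exists (Num.truncn (t 0%N / u)).+1; exact: truncnS_gt.
have := tn n; have := te n; rewrite ltr_pdivrMr// in nN; lra.
Qed.

Variable delta : R.
Hypothesis delta0 : 0 < delta.
Hypothesis t_gt0 : forall n, 0 < t n.

Let g y := (minus_inv a f y)^-1.

Let a0 : 0 < a.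
Proof.
by have [u /andP[u0 ua] _] := f_small ltr01; exact: lt_le_trans ua.
Qed.

Let g_ni s u : 0 < s -> s <= u -> g u <= g s.
Proof.
move=> s0 su; rewrite /g lef_pV2 ?posrE ?minus_inv_gt0 ?minus_inv_nd//.
exact: lt_le_trans su.
Qed.

(** This supplies the positive lower bound [c] required by the integral lemmas: the inverse is a
    supremum over a part of (0, a]. *)
Let g_ge s : 0 < s -> a^-1 <= g s.
Proof. by move=> s0; rewrite lef_pV2 ?posrE ?minus_inv_gt0 ?minus_inv_le. Qed.

Let ainv0 : 0 < a^-1. Proof. by rewrite invr_gt0. Qed.

Let PhiD n : Phi a f delta (t n) + 1 <= Phi a f delta (t n.+1).
Proof.
rewrite addrC -lerBrDr /Phi.
rewrite (oriented_integralB g_ni ainv0 g_ge)//.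
have /andP[+ _] := int_nonincreasing_bounds g_ni ainv0 g_ge (t_gt0 n.+1) (t_ni n).
apply: le_trans; rewrite /g ler_pdivlMr ?mul1r ?minus_inv_gt0//.
by rewrite minus_inv_le_of// subr_ge0.
Qed.

Let PhiDn n : Phi a f delta (t 0%N) + n%:R <= Phi a f delta (t n).
Proof.
elim: n => [|n IH]; first by rewrite addr0.
by rewrite (le_trans _ (PhiD n))// -natr1 addrA lerD2r.
Qed.

(** The target [y] lies between the values of [Phi] at [t 0] and [t n], so it is attained at some
    [z >= t n], and injectivity identifies [z] with [Phi_inv y]. Membership in the range is stated
    as well, since [Phi_inv] is meaningful only there. *)
Lemma Phi_rate n (y := Phi a f delta (t 0%N) + n%:R) :
  (Phi a f delta @` `]0, +oo[) y /\ t n <= Phi_inv a f delta y.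
Proof.
have tn0 : t n <= t 0%N.
  by elim: (n) => // k; apply: le_trans.
have [z tz zy] : exists2 z, t n <= z & Phi a f delta z = y.
  apply: (oriented_integral_image g_ni ainv0 g_ge delta0 (t_gt0 n) tn0).
  by rewrite lerDl ler0n/=; exact: PhiDn.
have z0 : z \in `]0, +oo[%classic.
  by rewrite inE/= in_itv/= andbT (lt_le_trans (t_gt0 n)).
split; first by exists z => //; rewrite inE in z0.
rewrite /Phi_inv -zy pinvKV//.
exact: oriented_integral_inj g_ni ainv0 g_ge _ delta0.
Qed.

End rate.

(** * Distance to a set and Fejer monotone sequences *)

Section fejer.
Context {R : realType} {E : vectType R} (ip : {dot E for idfun}).
Local Notation N := (eucl_norm ip).
Implicit Types (F : set E) (x y z : E).

Lemma eucl_dist_le F x z : F z -> eucl_dist ip x F <= N (x - z).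
Proof.
move=> Fz; apply: ge_inf; last by exists z.
by exists 0 => _ [y _ <-]; exact: eucl_norm_ge0.
Qed.

Lemma le_eucl_dist F x r : F !=set0 -> (forall z, F z -> r <= N (x - z)) ->
  r <= eucl_dist ip x F.
Proof.
move=> [z Fz] Fr; apply: lb_le_inf; first by exists (N (x - z)), z.
by move=> _ [y Fy <-]; exact: Fr.
Qed.

Lemma eucl_dist_ge0 F x : F !=set0 -> 0 <= eucl_dist ip x F.
Proof. by move=> F0; apply: le_eucl_dist => // z _; exact: eucl_norm_ge0. Qed.

Lemma eucl_dist_lt F x r : F !=set0 -> eucl_dist ip x F < r ->
  exists2 z, F z & N (x - z) < r.
Proof.
move=> [z Fz] /inf_lt[|_ [y Fy <-] yr]; first by exists (N (x - z)), z.
by exists y.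
Qed.

(** Once an iterate is near some [z] in [F], all later ones are at least as near, which makes the
    sequence Cauchy. For a general [F] the limit is only at distance zero; membership is settled by
    [common_fixpoints_dist0]. *)
Lemma fejer_cvg F (x : nat -> E) : F !=set0 ->
  (forall k z, F z -> N (x k.+1 - z) <= N (x k - z)) ->
  (forall e, 0 < e -> exists k, eucl_dist ip (x k) F < e) ->
  exists2 l, eucl_cvg ip x l & eucl_dist ip l F = 0.
Proof.
move=> F0 xF dist0.
have xFn k j z : F z -> N (x (k + j)%N - z) <= N (x k - z).
  move=> Fz; elim: j => [|j IH]; first by rewrite addn0.
  by rewrite addnS (le_trans (xF _ _ Fz)).
have close e : 0 < e -> exists K z, F z /\
    forall k, (K <= k)%N -> N (x k - z) < e.
  move=> e0; have [K /(eucl_dist_lt F0)[z Fz Kz]] := dist0 e e0.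
  exists K, z; split => // k Kk.
  by rewrite -(subnKC Kk) (le_lt_trans (xFn _ _ _ Fz)).
have [|l xl] := @eucl_complete _ _ ip x.
  move=> e e0; have [K [z [_ Kz]]] := close (e / 2) ltac:(by rewrite divr_gt0).
  exists K => k Kk; rewrite (le_trans (ler_eucl_dist_add ip z _ _))//.
  rewrite (eucl_normB _ z); have := Kz k Kk; have := Kz K (leqnn _); lra.
exists l => //; apply/eqP; rewrite eq_le eucl_dist_ge0// andbT.
apply/ler_addgt0Pr => e e0; rewrite add0r.
have [K [z [Fz Kz]]] := close (e / 2) ltac:(by rewrite divr_gt0).
have [K' _ xl'] := cvgr0_norm_lt _ xl _ (ltac:(by rewrite divr_gt0) : 0 < e / 2).
have := xl' (maxn K K') (leq_maxr _ _).
have := Kz (maxn K K') (leq_maxl _ _).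
rewrite ger0_norm ?eucl_norm_ge0// (eucl_normB _ _ l).
have := ler_eucl_dist_add ip (x (maxn K K')) l z.
have := eucl_dist_le l Fz; lra.
Qed.

End fejer.

(** * Averaged operators and their common fixed points *)

Section averaged_operators.
Context {R : realType} {E : vectType R} (ip : {dot E for idfun}).
Variables (alpha : R) (T : E -> E).
Hypothesis alpha01 : 0 < alpha < 1.
Hypothesis Ta : averaged ip alpha T.

Lemma averagedB (S : E -> E) x y :
  (forall x, T x = (1 - alpha) *: x + alpha *: S x) ->
  T x - T y = (1 - alpha) *: (x - y) + alpha *: (S x - S y).
Proof. by move=> TS; rewrite !TS !scalerBr [RHS]addrACA opprD. Qed.

Lemma averaged_residual (S : E -> E) x :
  (forall x, T x = (1 - alpha) *: x + alpha *: S x) ->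
  x - T x = alpha *: (x - S x).
Proof.
move=> ->; rewrite scalerBl scale1r -addrA opprD addrA subrr add0r.
by rewrite opprD opprK scalerBr.
Qed.

(* With [T = (1 - alpha) I + alpha S] and [a + b = 1],
   [|a u + b v|^2 = a |u|^2 + b |v|^2 - a b |u - v|^2]. *)
Lemma averaged_descent x z : T z = z ->
  ip (T x - z) (T x - z) + (1 - alpha) / alpha * ip (x - T x) (x - T x)
  <= ip (x - z) (x - z).
Proof.
move=> Tz; have [S Sn TS] := Ta; have /andP[al0 al1] := alpha01.
(* From [z - T z = alpha *: (z - S z)] and alpha nonzero, [z] is also fixed by [S]. *)
have Sz : S z = z.
  have /eqP := averaged_residual z TS.
  by rewrite Tz subrr eq_sym scaler_eq0 gt_eqF//= subr_eq0 => /eqP.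
have -> : T x - z = (1 - alpha) *: (x - z) + alpha *: (S x - z).
  by rewrite -{1}Tz (averagedB _ _ TS) Sz.
have -> : x - T x = alpha *: ((x - z) - (S x - z)).
  by rewrite (averaged_residual _ TS) opprB addrA subrK.
have := Sn x z; rewrite Sz ler_eucl_norm; move: (x - z) (S x - z) => u v vu.
apply: (@le_trans _ _ ((1 - alpha) * ip u u + alpha * ip v v)).
  rewrite !(ipDl, ipDr, ipNl, ipNr, ipZl, ipZr) (ipC ip v u).
  rewrite le_eqVlt; apply/orP; left; apply/eqP; field.
  by rewrite gt_eqF.
by have := ler_wpM2l (ltW al0) vu; lra.
Qed.

Lemma averaged_nonexpansive : nonexpansive ip T.
Proof.
move=> x y; have [S Sn TS] := Ta; have /andP[al0 al1] := alpha01.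
rewrite (averagedB _ _ TS) (le_trans (ler_eucl_normD _ _ _))// !eucl_normZ.
rewrite (gtr0_norm al0) gtr0_norm ?subr_gt0//.
by have := ler_wpM2l (ltW al0) (Sn x y); lra.
Qed.

End averaged_operators.

(** This is closedness of the common fixed-point set: if [z] is a common fixed point near [l], then
    |T_i l - l| <= |T_i l - T_i z| + |z - l| <= 2 |l - z|. *)
Lemma common_fixpoints_dist0 {R : realType} {E : vectType R}
    (ip : {dot E for idfun}) m (T : 'I_m -> E -> E) l :
  (forall i, nonexpansive ip (T i)) -> common_fixpoints T !=set0 ->
  eucl_dist ip l (common_fixpoints T) = 0 -> common_fixpoints T l.
Proof.
move=> Tn F0 l0 i _ /=; apply/eqP; rewrite -subr_eq0; apply/eqP.
apply: (@eucl_norm_eq0 _ _ ip); apply/eqP; rewrite eq_le eucl_norm_ge0 andbT.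
apply/ler_addgt0Pr => e e0; rewrite add0r.
have [|z Fz lz] := @eucl_dist_lt _ _ ip _ l (e / 2) F0.
  by rewrite l0 divr_gt0.
have := ler_eucl_dist_add ip z (T i l) l.
have := Tn i l z; rewrite (Fz i I) (eucl_normB _ z); lra.
Qed.

(** * Descent along the quasi-cyclic iteration *)

Section quasi_cyclic.
Context {R : realType} {E : vectType R} (ip : {dot E for idfun}).
Variables (alpha : R) (m : nat) (T : 'I_m -> E -> E).
Variables (w : nat -> 'I_m -> R) (x : nat -> E).
Hypothesis alpha01 : 0 < alpha < 1.
Hypothesis Ta : forall i, averaged ip alpha (T i).
Hypothesis F0 : common_fixpoints T !=set0.
Hypothesis w0 : forall k i, 0 <= w k i.
Hypothesis w1 : forall k, \sum_(i < m) w k i = 1.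
Hypothesis nu0 : 0 < weight_inf w.
Hypothesis xS : forall k, x k.+1 = \sum_(i < m) w k i *: T i (x k).
Local Notation N := (eucl_norm ip).
Local Notation F := (common_fixpoints T).
Local Notation nu := (weight_inf w).
Local Notation c := ((1 - alpha) / alpha).
Local Notation residual k :=
  (\sum_(i < m) w k i * ip (x k - T i (x k)) (x k - T i (x k))).

Let c0 : 0 < c.
Proof. by have /andP[al0 al1] := alpha01; rewrite divr_gt0 ?subr_gt0. Qed.

Let residual_ge0 k : 0 <= residual k.
Proof. by apply: sumr_ge0 => i _; rewrite mulr_ge0 ?ip_ge0. Qed.

Lemma weight_ge k i : 0 < w k i -> nu <= w k i.
Proof.
move=> wki; apply: (@le_trans _ _ (\big[Num.min/1]_(i in Iplus w k) w k i)).
  apply: ge_inf; last by exists k.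
  exists 0 => _ [j _ <-]; elim/big_ind: _ => // u v u0 v0.
  by rewrite le_min u0.
by apply: bigmin_le_cond; rewrite inE.
Qed.

Lemma iterateB k z : x k.+1 - z = \sum_i w k i *: (T i (x k) - z).
Proof.
under eq_bigr do rewrite scalerBr.
by rewrite sumrB -scaler_suml w1 scale1r xS.
Qed.

(** The descent inequalities of the individual operators, averaged with the weights; convexity
    passes the squared norm inside the sum. *)
Lemma step_descent k z : F z ->
  ip (x k.+1 - z) (x k.+1 - z) + c * residual k <= ip (x k - z) (x k - z).
Proof.
move=> Fz; rewrite iterateB.
apply: (le_trans (lerD (ip_convex ip _ (w0 k) (w1 k)) (lexx _))).
rewrite mulr_sumr -big_split/= -[leRHS]mul1r -[X in _ <= X * _](w1 k) mulr_suml.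
apply: ler_sum => i _; rewrite mulrCA -mulrDr ler_wpM2l//.
exact: averaged_descent alpha01 (Ta i) _ _ (Fz i I).
Qed.

Lemma step_fejer k z : F z -> N (x k.+1 - z) <= N (x k - z).
Proof.
move=> Fz; rewrite ler_eucl_norm (le_trans _ (step_descent k Fz))//.
by rewrite lerDl mulr_ge0 ?residual_ge0// ltW.
Qed.

Lemma iterates_bounded : eucl_bounded ip (range x).
Proof.
have [z Fz] := F0; exists (N (x 0%N - z) + N z) => _ [k _ <-].
have xk : N (x k - z) <= N (x 0%N - z).
  by elim: k => // k; apply: le_trans; exact: step_fejer.
by rewrite -{1}[x k](subrK z) (le_trans (ler_eucl_normD _ _ _))// lerD2r.
Qed.

Lemma descent k n z : F z ->
  ip (x (k + n)%N - z) (x (k + n)%N - z) + c * \sum_(j < n) residual (k + j)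
  <= ip (x k - z) (x k - z).
Proof.
move=> Fz; elim: n => [|n IH]; first by rewrite big_ord0 mulr0 addr0 addn0.
rewrite big_ord_recr addnS/=.
by have := step_descent (k + n) Fz; lra.
Qed.

(** The displacement telescopes into [n] steps, whence the factor [n]; convexity bounds each squared
    step by its residual. *)
Lemma displacement_le k n :
  ip (x (k + n)%N - x k) (x (k + n)%N - x k)
  <= n%:R * \sum_(j < n) residual (k + j).
Proof.
have -> : x (k + n)%N - x k = \sum_(j < n) (x (k + j).+1 - x (k + j)%N).
  elim: n => [|n IH]; first by rewrite big_ord0 addn0 subrr.
  by rewrite big_ord_recr/= -IH addnS addrC subrKA.
apply: (le_trans (ip_sum_le _ _)); rewrite ler_wpM2l//; apply: ler_sum => j _.
rewrite iterateB (le_trans (ip_convex ip _ (w0 _) (w1 _)))//.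
apply: ler_sum => i _; rewrite ler_wpM2l// -ler_eucl_norm eucl_normB.
exact: lexx.
Qed.

(** * Blocks of [s] steps and the regularity bound *)

Variable s : nat.
Hypothesis cover :
  forall k, (\bigcup_(j < s) Iplus w (k + j))%SET = [set: 'I_m]%SET.

Lemma residual_le k i :
  N (x k - T i (x k)) ^+ 2 <=
  2 * (1 + 4 * nu * s%:R) / nu * \sum_(j < s) residual (k + j).
Proof.
have /bigcupP[j _] : i \in (\bigcup_(j < s) Iplus w (k + j))%SET.
  by rewrite cover inE.
rewrite inE => wi; set S := \sum_(j < s) _.
(* [p] measures the move up to a time [k + j] at which [i] is active, and [q] the residual of [T i]
   at that time. *)
pose p := N (x (k + j)%N - x k); pose q := N (x (k + j)%N - T i (x (k + j)%N)).
have S_split : S = \sum_(l < j) residual (k + l)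
     + \sum_(j <= l < s) residual (k + l).
  rewrite /S -(big_mkord xpredT (fun l => residual (k + l))).
  by rewrite (big_cat_nat (n := j))//= ?big_mkord// ltnW.
have S2 : 0 <= \sum_(j <= l < s) residual (k + l) by rewrite sumr_ge0.
have S1 : 0 <= \sum_(l < j) residual (k + l) by rewrite sumr_ge0.
have pS : p ^+ 2 <= s%:R * S.
  rewrite eucl_norm_sqr (le_trans (displacement_le _ _))// ler_pM//.
    by rewrite ler_nat ltnW.
  by rewrite S_split lerDl.
have qS : nu * q ^+ 2 <= S.
  apply: (@le_trans _ _ (residual (k + j))).
    rewrite eucl_norm_sqr (bigD1 i)//=.
    apply: (@le_trans _ _ (w (k + j)%N i *
      ip (x (k + j)%N - T i (x (k + j)%N)) (x (k + j)%N - T i (x (k + j)%N)))).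
      by rewrite ler_wpM2r ?ip_ge0// weight_ge.
    by rewrite lerDl sumr_ge0// => l _; rewrite mulr_ge0 ?ip_ge0.
  by rewrite /S (bigD1 j)//= lerDl sumr_ge0.
(* One [p] goes from [x k] to [x (k + j)]; nonexpansiveness of [T i] costs the other on the way
   back. *)
have xTx : N (x k - T i (x k)) <= 2 * p + q.
  have := ler_eucl_dist_add ip (x (k + j)%N) (x k) (T i (x k)).
  have := ler_eucl_dist_add ip (T i (x (k + j)%N)) (x (k + j)%N) (T i (x k)).
  have := averaged_nonexpansive alpha01 (Ta i) (x (k + j)%N) (x k).
  rewrite (eucl_normB _ (x k) (x (k + j)%N)) -/p -/q; lra.
apply: (@le_trans _ _ ((2 * p + q) ^+ 2)).
  by rewrite ler_sqr ?nnegrE ?eucl_norm_ge0// (le_trans _ xTx) ?eucl_norm_ge0.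
apply: (@le_trans _ _ (8 * p ^+ 2 + 2 * q ^+ 2)).
  (* The gap between the two sides is exactly (2 p - q)^2. *)
  by have := sqr_ge0 (2 * p - q); lra.
rewrite -(ler_pM2l nu0).
have -> : nu * (2 * (1 + 4 * nu * s%:R) / nu * S) =
    2 * S + 8 * (nu * (s%:R * S)) by field; rewrite gt_eqF.
have := ler_wpM2l (ltW nu0) pS; lra.
Qed.

(** The infimum over [z] of [descent]. As the distance is an infimum of norms rather than of
    squares, the square root of the left side is shown to be a lower bound for every norm. *)
Lemma dist_descent k n :
  eucl_dist ip (x (k + n)%N) F ^+ 2 + c * \sum_(j < n) residual (k + j)
  <= eucl_dist ip (x k) F ^+ 2.
Proof.
set S := \sum_(j < n) _; have S0 : 0 <= S by rewrite sumr_ge0.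
have d0 k' := eucl_dist_ge0 ip (x k') F0.
have D0 : 0 <= eucl_dist ip (x (k + n)%N) F ^+ 2 + c * S.
  by rewrite addr_ge0 ?sqr_ge0// mulr_ge0// ltW.
rewrite -[leLHS]sqr_sqrtr// ler_sqr ?nnegrE ?sqrtr_ge0//.
apply: le_eucl_dist => // z Fz.
rewrite -ler_sqr ?nnegrE ?sqrtr_ge0 ?eucl_norm_ge0// sqr_sqrtr//.
rewrite eucl_norm_sqr (le_trans _ (descent k n Fz))// lerD2r -eucl_norm_sqr.
by rewrite ler_sqr ?nnegrE ?eucl_norm_ge0// eucl_dist_le.
Qed.

Lemma dist_ni k n : eucl_dist ip (x (k + n)%N) F <= eucl_dist ip (x k) F.
Proof.
rewrite -ler_sqr ?nnegrE ?eucl_dist_ge0// (le_trans _ (dist_descent k n))//.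
by rewrite lerDl mulr_ge0 ?sumr_ge0// ltW.
Qed.

Variables (B : set E) (psi : R -> R).
Hypothesis xB : range x `<=` B.
Hypothesis psi_ge0 : forall t, 0 <= t -> 0 <= psi t.
Hypothesis psi_nd : forall t u, 0 <= t -> t <= u -> psi t <= psi u.
Hypothesis psi_reg : forall y, B y ->
  eucl_dist ip y F <= psi (\big[Num.max/0]_(i < m) N (y - T i y)).

Lemma dist_phihat k :
  eucl_dist ip (x k) F ^+ 2 <=
  phihat alpha nu s psi
    (eucl_dist ip (x k) F ^+ 2 - eucl_dist ip (x (k + s)%N) F ^+ 2).
Proof.
set D := _ - _; rewrite /phihat; set r := Num.sqrt _.
have max0 : 0 <= \big[Num.max/0]_(i < m) N (x k - T i (x k)).
  exact: bigmax_ge_id.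
have r0 : 0 <= r by exact: sqrtr_ge0.
rewrite ler_sqr ?nnegrE ?eucl_dist_ge0 ?psi_ge0//.
apply: (le_trans (psi_reg (xB _))); first by exists k.
apply: psi_nd => //; apply/bigmax_leP; split => // i _.
rewrite -[leLHS]ger0_norm ?eucl_norm_ge0// -sqrtr_sqr ler_wsqrtr//.
apply: (le_trans (residual_le k i)).
have := dist_descent k s; rewrite addrC -lerBrDr -/D mulrC.
have /andP[al0 al1] := alpha01.
rewrite mulrA ler_pdivrMr// => H.
have K0 : 0 <= 2 * (1 + 4 * nu * s%:R) / nu.
  by rewrite divr_ge0 ?ltW// mulr_gt0// ltr_pwDl// !mulr_ge0// ltW.
rewrite -ler_pdivlMr ?subr_gt0// in H.
(* [H] bounds the residual sum by D alpha / (1 - alpha); the factor 2 (1 + 4 nu s) / nu then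
   produces exactly the constant of [phihat]. *)
apply: (le_trans (ler_wpM2l K0 H)); rewrite le_eqVlt; apply/orP; left.
apply/eqP; have := nu0; move: (weight_inf w) => v v0; field.
by rewrite !gt_eqF ?subr_gt0.
Qed.

End quasi_cyclic.

(** * Smallness of [phihat] near 0 and assembly of the theorem *)

Lemma phihat_small {R : realType} (alpha nu : R) s (psi : R -> R) (a y : R) :
  0 < 2 * alpha * (1 + 4 * nu * s%:R) / (nu * (1 - alpha)) ->
  (forall t, 0 <= t -> 0 <= psi t) -> psi t @[t --> 0^'+] --> (0 : R) ->
  0 < a -> 0 < y -> exists2 u, 0 < u <= a & phihat alpha nu s psi u < y.
Proof.
rewrite /phihat; move: (_ / _) => k k0 psi_ge0 psi0 a0 y0.
have sy0 : 0 < Num.sqrt y by rewrite sqrtr_gt0.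
have small_psi := cvgr0_norm_lt _ psi0 _ sy0.
have [d /= d0 dP] := small_psi.
(* The witness u = t^2 / k makes the argument of [psi] equal to [t]. The first cap makes [psi t]
   small, the second gives u <= a. *)
pose t := Num.min (d / 2) (Num.sqrt (k * a)).
have t0 : 0 < t by rewrite lt_min divr_gt0//= sqrtr_gt0 mulr_gt0.
exists (t ^+ 2 / k).
  rewrite divr_gt0 ?exprn_gt0//= ler_pdivrMr// [leRHS]mulrC.
  rewrite -[leRHS](sqr_sqrtr (ltW (mulr_gt0 k0 a0))).
  rewrite ler_sqr ?nnegrE ?sqrtr_ge0 ?(ltW t0)//.
  by rewrite ge_min lexx orbT.
rewrite mulrC divfK ?gt_eqF// sqrtr_sqr gtr0_norm//.
have := dP t; rewrite /ball_/= sub0r normrN gtr0_norm// => /(_ _ t0).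
rewrite ger0_norm ?psi_ge0 ?(ltW t0)// => H.
rewrite -[ltRHS](sqr_sqrtr (ltW y0)).
rewrite ltr_sqr ?nnegrE ?sqrtr_ge0 ?psi_ge0 ?(ltW t0)//.
by apply: H; rewrite gt_min; apply/orP; left; lra.
Qed.

Theorem theorem3p7 (R : realType) (E : vectType R) (ip : {dot E for idfun})
    (alpha : R) (m : nat) (T : 'I_m -> E -> E)
    (w : nat -> 'I_m -> R) (x : nat -> E) :
  0 < alpha < 1 ->
  (forall i, averaged ip alpha (T i)) ->
  common_fixpoints T !=set0 ->
  common_fixpoints T <> [set: E] ->
  (forall k i, 0 <= w k i) ->
  (forall k, \sum_(i < m) w k i = 1) ->
  0 < weight_inf w ->
  (forall k, x k.+1 = \sum_(i < m) w k i *: T i (x k)) ->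
  eucl_bounded ip (range x) /\
  forall (B : set E) (psi : R -> R) (s : nat) (ahat delta : R),
    eucl_bounded ip B ->
    range x `<=` B ->
    jointly_Karamata_regular ip T B psi ->
    (0 < s)%N ->
    (forall k, (\bigcup_(j < s) Iplus w (k + j))%SET = [set: 'I_m]%SET) ->
    eucl_dist ip (x 0%N) (common_fixpoints T) ^+ 2 < ahat ->
    0 < delta ->
    let F := common_fixpoints T in
    let f := phihat alpha (weight_inf w) s psi in
    exists xstar : E,
      [/\ F xstar,
          eucl_cvg ip x xstar &
          (exists K : nat, forall k : nat, (K <= k)%N -> x k = xstar) \/
          (forall k : nat,
             let y := Phi ahat f delta (eucl_dist ip (x 0%N) F ^+ 2)
                      + (k %/ s)%:R in
             (Phi ahat f delta @` `]0, +oo[) y /\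
             eucl_dist ip (x k) F <= Num.sqrt (Phi_inv ahat f delta y))].
Proof.
move=> alpha01 Ta F0 _ w0 w1 nu0 xS; split.
  exact: iterates_bounded alpha01 Ta F0 w0 w1 xS.
move=> B psi s ahat delta _ xB [_ _ psi_ge0 [psi_reg [psi_nd psi0 psi00] _]].
move=> s_gt0 cover ahat_gt delta0 F f.
have [al0 al1] := andP alpha01.
pose D k := eucl_dist ip (x k) F ^+ 2.
have D_ge0 k : 0 <= D k by exact: sqr_ge0.
have Dstep k : D k <= f (D k - D (k + s)%N).
  exact: (dist_phihat alpha01 Ta F0 w0 w1 nu0 xS cover xB psi_ge0 psi_nd
    psi_reg).
have d_ni k n : eucl_dist ip (x (k + n)%N) F <= eucl_dist ip (x k) F.
  exact: (dist_ni alpha01 Ta F0 w0 w1 xS).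
have d_ge0 k := eucl_dist_ge0 ip (x k) F0.
have ahat0 : 0 < ahat := le_lt_trans (D_ge0 0%N) ahat_gt.
have k0 : 0 < 2 * alpha * (1 + 4 * weight_inf w * s%:R)
                / (weight_inf w * (1 - alpha)).
  have q0 : 0 < 1 + 4 * weight_inf w * s%:R.
    by rewrite ltr_pwDl// !mulr_ge0// ltW.
  by rewrite divr_gt0// !mulr_gt0// subr_gt0.
have f_nd u v : 0 <= u -> u <= v -> f u <= f v.
  move=> u0 uv; rewrite /f /phihat ler_sqr ?nnegrE ?psi_ge0 ?sqrtr_ge0//.
  by apply: psi_nd; rewrite ?sqrtr_ge0// ler_wsqrtr// ler_wpM2l// ltW.
have f_small y : 0 < y -> exists2 u, 0 < u <= ahat & f u < y.
  exact: phihat_small.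
(* Sampling the squared distance once per block turns [Dstep] into the scalar recursion. *)
pose t n := D (n * s)%N.
have t_step n : t n <= f (t n - t n.+1) by rewrite /t mulSn addnC; exact: Dstep.
have t_ni n : t n.+1 <= t n.
  by rewrite /t mulSn addnC ler_sqr ?nnegrE ?d_ge0.
have [l xl l0] : exists2 l, eucl_cvg ip x l & eucl_dist ip l F = 0.
  apply: fejer_cvg => //.
    by move=> k z; exact: (step_fejer alpha01 Ta w0 w1 xS).
  move=> e e0; have [n tn] := step_cvg0 f_nd f_small t_step t_ni (exprn_gt0 2 e0).
  by exists (n * s)%N; rewrite -ltr_sqr ?nnegrE ?d_ge0 ?ltW.
have Tn i : nonexpansive ip (T i) by exact: averaged_nonexpansive alpha01 (Ta i).
(* If the distance vanishes at some [K], then [x K] is fixed by every operator and the sequence is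
   constant from there on. Otherwise all distances are positive, as the rate lemma requires. *)
have [[K DK0]|D_neq0] := pselect (exists k, D k = 0).
  have FxK : F (x K).
    apply: (common_fixpoints_dist0 Tn F0).
    by apply/eqP; rewrite -sqrf_eq0; apply/eqP.
  have xK k : (K <= k)%N -> x k = x K.
    move=> /subnKC <-; elim: (k - K)%N => [|n IH]; first by rewrite addn0.
    rewrite addnS xS IH -[RHS]scale1r -(w1 (K + n)%N) scaler_suml.
    by apply: eq_bigr => i _; rewrite (FxK i I).
  exists (x K); split => //; last by left; exists K.
  apply/cvgr0Pnorm_lt => e e0; exists K => // k /= /xK ->.
  by rewrite subrr eucl_norm0 normr0.
have D_gt0 k : 0 < D k.
  by rewrite lt_def D_ge0 andbT; apply/eqP => Dk0; apply: D_neq0; exists k.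
exists l; split => //; first exact: common_fixpoints_dist0 Tn F0 l0.
right=> k y.
have [] := Phi_rate f_nd f_small t_step t_ni delta0 (fun n => D_gt0 _) (k %/ s).
rewrite [t 0%N]/t mul0n -/y => y_img ty; split => //.
rewrite -[leLHS]ger0_norm// -sqrtr_sqr ler_wsqrtr// (le_trans _ ty)//.
rewrite ler_sqr ?nnegrE ?d_ge0//.
(* Within a block the distance does not increase, so [x k] inherits the bound at the start of its
   block. *)
by rewrite {1}(divn_eq k s) d_ni.
Qed.
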